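(* Let $n_1,n_2,n_3$ be positive integers and let $\Omega\subseteq[n_1]\times[n_2]\times[n_3]$ be a fixed index set. Let $\hat a\in\mathbb{R}^{n_1}$, $\hat b\in\mathbb{R}^{n_2}$, $\hat c\in\mathbb{R}^{n_3}$ be nonzero vectors with $\|\hat a\|=\|\hat b\|=1$, and let $\widehat{\mathcal{A}}=\hat a\otimes\hat b\otimes\hat c$. Let $Z$ be the matrix and $\hat\Psi$ the set of polynomials associated with $(\hat a,\hat b,\hat c)$ and $\Omega$ as defined in the context. Assume that $\mathrm{rank}\, Z=n_1+n_2$ and that the four pairs $(\pm\hat a,\pm\hat b)$ (all independent choices of signs) are the only common zeros $(a,b)$ with $\|a\|=\|b\|=1$ of the polynomials in $\hat\Psi$. Then there exist a constant $C_1>0$, depending on $(\hat a,\hat b,\hat c)$, and an $\varepsilon>0$ such that the following holds: for every $\mathcal{A}$ with observed entries $\mathcal{A}_{ijk}=\widehat{\mathcal{A}}_{ijk}+\delta\mathcal{A}_{ijk}$, $(i,j,k)\in\Omega$, satisfying $\|\delta\mathcal{A}\|_\Omega<\varepsilon$, and for every minimizer $(a^*,b^* )$ of the biquadratic optimization problem $$\min\ f(a,b)=\sum_{k=1}^{n_3}\ \sum_{1\le s<t\le m_k}\left(\mathcal{A}_{i_sj_sk}a_{i_t}b_{j_t}-\mathcal{A}_{i_tj_tk}a_{i_s}b_{j_s}\right)^2\quad\text{subject to}\quad \|a\|^2=\|b\|^2=1,$$ with $a\in\mathbb{R}^{n_1}$, $b\in\mathbb{R}^{n_2}$, it holds that $$\|a^*\otimes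 b^*-\theta\,\hat a\otimes\hat b\|\le C_1\,\|\delta\mathcal{A}\|_\Omega\quad\text{for some }\theta\in\{-1,1\}.$$
   Context: For a positive integer $n$, $[n]=\{1,\dots,n\}$; $\|\cdot\|$ is the Euclidean norm on vectors; $a\otimes b\in\mathbb{R}^{n_1n_2}$ is the Kronecker product of vectors; $(a\otimes b\otimes c)_{ijk}=a_ib_jc_k$; $e_i$ denotes a standard basis vector of the appropriate dimension. For a tensor, $\|\mathcal{B}\|_\Omega=\left(\sum_{(i,j,k)\in\Omega}|\mathcal{B}_{ijk}|^2\right)^{1/2}$. For each $k\in[n_3]$, let $\Omega_k=\{(i,j)\in[n_1]\times[n_2]:(i,j,k)\in\Omega\}$, let $m_k=|\Omega_k|$, and enumerate $\Omega_k=\{(i_1,j_1),\dots,(i_{m_k},j_{m_k})\}$ (the enumeration depends on $k$). For $k\in[n_3]$ and $1\le s<t\le m_k$, define the polynomial in $(a,b)\in\mathbb{R}^{n_1}\times\mathbb{R}^{n_2}$ $$\hat\psi_{s,t,k}(a,b)=\left(\widehat{\mathcal{A}}_{i_sj_sk}a_{i_t}b_{j_t}-\widehat{\mathcal{A}}_{i_tj_tk}a_{i_s}b_{j_s}\right)^2,$$ and let $\hat\Psi$ be the set of all polynomials $\hat\psi_{s,t,k}$ with $k\in[n_3]$, $1\le s<t\le m_k$. Define the column vectors $$\hat z_{s,t,k}=\sqrt2\,\hat c_k\begin{bmatrix}\hat a_{i_s}\hat b_{j_s}\hat b_{j_t}e_{i_t}-\hat a_{i_t}\hat b_{j_t}\hat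 b_{j_s}e_{i_s}\\ \hat a_{i_s}\hat b_{j_s}\hat a_{i_t}e_{j_t}-\hat a_{i_t}\hat b_{j_t}\hat a_{i_s}e_{j_s}\end{bmatrix}\in\mathbb{R}^{n_1+n_2}.$$ Let $\hat Z$ be the matrix whose rows are all the vectors $(\hat z_{s,t,k})^T$ with $k\in[n_3]$, $1\le s<t\le m_k$, and let $$Z=\begin{bmatrix}\hat Z\\ \hat D\end{bmatrix},\qquad \hat D=\begin{bmatrix}\hat a&0\\0&\hat b\end{bmatrix}^T\in\mathbb{R}^{2\times(n_1+n_2)}.$$ *)

(* Defs.v *)
From HB Require Import structures.
From mathcomp Require Import all_boot all_order all_algebra.
From mathcomp Require Import classical_sets reals.
From mathcomp Require Import mxtens.

Set Implicit Arguments.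
Unset Strict Implicit.
Unset Printing Implicit Defensive.

Import Order.TTheory GRing.Theory Num.Theory.

Local Open Scope ring_scope.

(* The library's norm on matrices is the max norm, hence this definition. *)
Definition enorm (R : realType) (n : nat) (v : 'cV[R]_n) : R :=
  Num.sqrt (\sum_(i < n) v i 0 ^+ 2).

(* tensmx yields 'M_(n1 * n2, 1 * 1), and 1 * 1 is convertible to 1;
   (a *t b) has the entry a_i b_j at position mxtens_index (i, j). *)
Definition kron (R : realType) (n1 n2 : nat) (a : 'cV[R]_n1) (b : 'cV[R]_n2) :
  'cV[R]_(n1 * n2) := a *t b.

Definition tensor (R : realType) (n1 n2 n3 : nat) : Type :=
  'I_n1 -> 'I_n2 -> 'I_n3 -> R.

Definition outer3 (R : realType) (n1 n2 n3 : nat)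
    (a : 'cV[R]_n1) (b : 'cV[R]_n2) (c : 'cV[R]_n3) : tensor R n1 n2 n3 :=
  fun i j k => a i 0 * b j 0 * c k 0.

Definition index_set (n1 n2 n3 : nat) : Type :=
  {set 'I_n1 * 'I_n2 * 'I_n3}.

Definition tensor_norm (R : realType) (n1 n2 n3 : nat)
    (Omega : index_set n1 n2 n3) (B : tensor R n1 n2 n3) : R :=
  Num.sqrt (\sum_(p in Omega) `|B p.1.1 p.1.2 p.2| ^+ 2).

Definition slice (n1 n2 n3 : nat) (Omega : index_set n1 n2 n3) (k : 'I_n3) :
  {set 'I_n1 * 'I_n2} :=
  [set ij : 'I_n1 * 'I_n2 | (ij.1, ij.2, k) \in Omega]%SET.

Definition enumeration (n1 n2 n3 : nat) (Omega : index_set n1 n2 n3) : Type :=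
  forall k : 'I_n3, 'I_#|slice Omega k| -> 'I_n1 * 'I_n2.

(* w k s is (i_s, j_s). As s ranges over exactly #|slice Omega k| values,
   the map s |-> w k s is automatically injective. *)
Definition enumerates (n1 n2 n3 : nat) (Omega : index_set n1 n2 n3)
    (w : enumeration Omega) : Prop :=
  forall k : 'I_n3, [set w k s | s : 'I_#|slice Omega k|]%SET = slice Omega k.

Definition psi (R : realType) (n1 n2 n3 : nat) (Omega : index_set n1 n2 n3)
    (w : enumeration Omega) (A : tensor R n1 n2 n3)
    (k : 'I_n3) (s t : 'I_#|slice Omega k|) (a : 'cV[R]_n1) (b : 'cV[R]_n2) : R :=
  let: (i_s, j_s) := w k s in
  let: (i_t, j_t) := w k t in
  (A i_s j_s k * (a i_t 0 * b j_t 0) - A i_t j_t k * (a i_s 0 * b j_s 0)) ^+ 2.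

(* The polynomials are represented by the functions they induce. *)
Definition Psi (R : realType) (n1 n2 n3 : nat) (Omega : index_set n1 n2 n3)
    (w : enumeration Omega) (A : tensor R n1 n2 n3) :
  set ('cV[R]_n1 -> 'cV[R]_n2 -> R) :=
  [set p | exists (k : 'I_n3) (s t : 'I_#|slice Omega k|),
             (s < t)%N /\ p = psi w A s t]%classic.

Definition common_zero (R : realType) (n1 n2 : nat)
    (P : set ('cV[R]_n1 -> 'cV[R]_n2 -> R)) (a : 'cV[R]_n1) (b : 'cV[R]_n2) : Prop :=
  forall p, P p -> p a b = 0.

Definition zvec (R : realType) (n1 n2 n3 : nat) (Omega : index_set n1 n2 n3)
    (w : enumeration Omega)
    (a : 'cV[R]_n1) (b : 'cV[R]_n2) (c : 'cV[R]_n3)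
    (k : 'I_n3) (s t : 'I_#|slice Omega k|) : 'cV[R]_(n1 + n2) :=
  let: (i_s, j_s) := w k s in
  let: (i_t, j_t) := w k t in
  (Num.sqrt 2 * c k 0) *:
  col_mx
    ((a i_s 0 * b j_s 0 * b j_t 0) *: delta_mx i_t 0
       - (a i_t 0 * b j_t 0 * b j_s 0) *: delta_mx i_s 0)
    ((a i_s 0 * b j_s 0 * a i_t 0) *: delta_mx j_t 0
       - (a i_t 0 * b j_t 0 * a i_s 0) *: delta_mx j_s 0).

Definition triples (n1 n2 n3 : nat) (Omega : index_set n1 n2 n3) : finType :=
  {k : 'I_n3 &
    {st : 'I_#|slice Omega k| * 'I_#|slice Omega k| | (st.1 < st.2)%N}}.

Definition Zhat (R : realType) (n1 n2 n3 : nat) (Omega : index_set n1 n2 n3)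
    (w : enumeration Omega)
    (a : 'cV[R]_n1) (b : 'cV[R]_n2) (c : 'cV[R]_n3) :
  'M[R]_(#|triples Omega|, n1 + n2) :=
  \matrix_(r < #|triples Omega|)
    let: existT k st := enum_val r in
    (zvec w a b c (val st).1 (val st).2)^T.

Definition Dhat (R : realType) (n1 n2 : nat) (a : 'cV[R]_n1) (b : 'cV[R]_n2) :
  'M[R]_(2, n1 + n2) :=
  (block_mx a 0 0 b)^T.

Definition Zmat (R : realType) (n1 n2 n3 : nat) (Omega : index_set n1 n2 n3)
    (w : enumeration Omega)
    (a : 'cV[R]_n1) (b : 'cV[R]_n2) (c : 'cV[R]_n3) :
  'M[R]_(#|triples Omega| + 2, n1 + n2) :=
  col_mx (Zhat w a b c) (Dhat a b).

Definition objective (R : realType) (n1 n2 n3 : nat) (Omega : index_set n1 n2 n3)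
    (w : enumeration Omega) (A : tensor R n1 n2 n3)
    (a : 'cV[R]_n1) (b : 'cV[R]_n2) : R :=
  \sum_(k < n3) \sum_(s < #|slice Omega k|)
    \sum_(t < #|slice Omega k| | (s < t)%N) psi w A s t a b.

Definition feasible (R : realType) (n1 n2 : nat)
    (a : 'cV[R]_n1) (b : 'cV[R]_n2) : Prop :=
  enorm a ^+ 2 = 1 /\ enorm b ^+ 2 = 1.

Definition minimizer (R : realType) (n1 n2 n3 : nat) (Omega : index_set n1 n2 n3)
    (w : enumeration Omega) (A : tensor R n1 n2 n3)
    (a : 'cV[R]_n1) (b : 'cV[R]_n2) : Prop :=
  feasible a b /\
  forall (x : 'cV[R]_n1) (y : 'cV[R]_n2),
    feasible x y -> objective w A a b <= objective w A x y.

(* Main.v *)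
Require Import Defs.
From HB Require Import structures.
From mathcomp Require Import all_boot all_order all_algebra.
From mathcomp Require Import boolp classical_sets reals.
From mathcomp Require Import mxtens ring lra.
From mathcomp Require Import topology normedtype derive.
Import Order.TTheory GRing.Theory Num.Theory.
Import numFieldNormedType.Exports.
Local Open Scope ring_scope.

(** Write ah, bh, ch for the exact factors, F for the objective of the exact
tensor outer3 ah bh ch, and T for the norm of the perturbation dA on Omega.
The proof compares F with the squared distance from (a, b) to the set of
exact solutions.

The objective is a sum of squares of residuals, and a residual is bilinear in
the tensor and in the rank-one matrix a b^T.  At (ah, bh) the residuals of the
exact tensor vanish, so those of the perturbed tensor are residuals of dA and
their squares sum to O(T^2).  A minimizer (a, b) does at least as well, and
passing from the perturbed tensor back to the exact one costs O(T^2) again;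
hence F(a, b) = O(T^2) ([minimizer_objective_le]).

It remains to see that F grows quadratically away from its zeros
([objective_growth]).  Since F is even in a and in b separately, signs can be
chosen so that the inner products of a with ah and of b with bh are
nonnegative, and then only the zero (ah, bh) matters.
- Near (ah, bh), the derivative of the residuals along (u, v) is, up to the
  factor sqrt 2, the product of Zhat with (u, v), and the two rows of Dhat are
  the normals of the unit spheres.  Along the spheres those normal components
  are of second order, so full column rank of Z makes the derivative
  bounded below, and the remaining bilinear term in (u, v) is of higher order
  ([objective_growth_near]).
- Away from (ah, bh), F has no zero on a compact set, hence a positive lower
  bound there ([objective_lower_bound_far]), while the distance is bounded.

Finally the squared distance between the Kronecker products is at most the
squared distance between the pairs, because the sign choice gives inner
products alpha, beta at most 1 and 2 - 2 alpha beta <= (2 - 2 alpha) +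
(2 - 2 beta).  The growth bound holds for all unit pairs with these signs, so the
estimate is valid for perturbations of any size, and eps = 1 is an arbitrary
choice. *)

(** * Inner products of column vectors *)

Definition dot {R : realType} {n : nat} (x y : 'cV[R]_n) : R :=
  \sum_(i < n) x i 0 * y i 0.

Section Dot.
Context {R : realType} {n : nat}.
Implicit Types x y : 'cV[R]_n.

Lemma dotC x y : dot x y = dot y x.
Proof. by apply: eq_bigr => i _; rewrite mulrC. Qed.

Lemma dotBl x y z : dot (x - y) z = dot x z - dot y z.
Proof. by rewrite -sumrB; apply: eq_bigr => i _; rewrite !mxE mulrBl. Qed.

Lemma dotZl c x y : dot (c *: x) y = c * dot x y.
Proof. by rewrite mulr_sumr; apply: eq_bigr => i _; rewrite !mxE mulrA. Qed.

Lemma dot0l x : dot 0 x = 0.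
Proof. by apply: big1 => i _; rewrite mxE mul0r. Qed.

Lemma dot_sqrB x y : dot (x - y) (x - y) = dot x x - 2 * dot x y + dot y y.
Proof. by rewrite dotBl !(dotC _ (x - y)) !dotBl (dotC y x); ring. Qed.

Lemma dot_ge0 x : 0 <= dot x x.
Proof. by apply: sumr_ge0 => i _; rewrite -expr2 sqr_ge0. Qed.

Lemma sqr_coord_le_dot x i : x i 0 ^+ 2 <= dot x x.
Proof.
rewrite /dot (bigD1 i) //= -expr2 lerDl.
by apply: sumr_ge0 => j _; rewrite -expr2 sqr_ge0.
Qed.

Lemma enorm_dot x : enorm x ^+ 2 = dot x x.
Proof.
rewrite /enorm sqr_sqrtr; last by apply: sumr_ge0 => i _; rewrite sqr_ge0.
by apply: eq_bigr => i _; rewrite expr2.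
Qed.

Lemma enorm_ge0 x : 0 <= enorm x.
Proof. exact: sqrtr_ge0. Qed.

Lemma enorm1_dot x : dot x x = 1 -> enorm x = 1.
Proof.
rewrite -enorm_dot => /eqP; rewrite -[X in _ == X](expr1n _ 2%N).
by rewrite eqrXn2 ?enorm_ge0 // => /eqP.
Qed.

End Dot.

Lemma dot_col_mx {R : realType} {m n : nat} (u : 'cV[R]_m) (v : 'cV[R]_n) :
  dot (col_mx u v) (col_mx u v) = dot u u + dot v v.
Proof.
rewrite /dot big_split_ord /=; congr (_ + _); apply: eq_bigr => i _.
  by rewrite col_mxEu.
by rewrite col_mxEd.
Qed.

Lemma cauchy_schwarz_sum {R : realType} {I : finType} (x y : I -> R) :
  (\sum_i x i * y i) ^+ 2 <= (\sum_i x i ^+ 2) * (\sum_i y i ^+ 2).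
Proof.
have h : 0 <= \sum_i \sum_j (x i * y j - x j * y i) ^+ 2.
  by apply: sumr_ge0 => i _; apply: sumr_ge0 => j _; rewrite sqr_ge0.
(* Lagrange's identity *)
have e : \sum_i \sum_j (x i * y j - x j * y i) ^+ 2 =
    2 * ((\sum_i x i ^+ 2) * (\sum_i y i ^+ 2) - (\sum_i x i * y i) ^+ 2).
  transitivity (\sum_i \sum_j (x i ^+ 2 * y j ^+ 2 + x j ^+ 2 * y i ^+ 2
                  - 2 * ((x i * y i) * (x j * y j)))).
    by apply: eq_bigr => i _; apply: eq_bigr => j _; ring.
  under eq_bigr do rewrite sumrB big_split /= -!mulr_sumr -mulr_suml.
  rewrite sumrB big_split /= -mulr_suml -!mulr_sumr -mulr_suml.
  ring.
lra.
Qed.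

Lemma dot_kron {R : realType} {n1 n2 : nat} (a x : 'cV[R]_n1) (b y : 'cV[R]_n2) :
  dot (kron a b) (kron x y) = dot a x * dot b y.
Proof.
rewrite /dot mulr_suml.
under [RHS]eq_bigr do rewrite mulr_sumr.
rewrite pair_bigA /=.
rewrite (reindex (@mxtens_index n1 n2)) /=; last first.
  by exists (@mxtens_unindex n1 n2) => ? _; rewrite ?mxtens_indexK ?mxtens_unindexK.
apply: eq_bigr => -[i j] _ /=; rewrite /kron.
have e (u : 'cV[R]_n1) (v : 'cV[R]_n2) :
    (u *t v) (mxtens_index (i, j)) 0 = u i 0 * v j 0.
  by rewrite !mxE mxtens_indexK /=; congr (u _ _ * v _ _); exact: ord1.
by rewrite !e; ring.
Qed.

Lemma dot_mulmx_le {R : realType} {m n : nat} (B : 'M[R]_(m, n)) :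
  exists2 K, 0 <= K & forall y : 'cV[R]_n, dot (B *m y) (B *m y) <= K * dot y y.
Proof.
exists (\sum_i \sum_j B i j ^+ 2).
  by apply: sumr_ge0 => i _; apply: sumr_ge0 => j _; rewrite sqr_ge0.
move=> y; rewrite mulr_suml; apply: ler_sum => i _.
rewrite mxE -expr2; apply: le_trans (cauchy_schwarz_sum _ _) _.
by rewrite le_eqVlt; apply/orP; left; apply/eqP; congr (_ * _); apply: eq_bigr.
Qed.

(** A matrix of full column rank has a left inverse, and a bound on the left
inverse is a lower bound on the matrix. *)
Lemma full_col_rank_coercive {R : realType} {m n : nat} (A : 'M[R]_(m, n)) :
  \rank A = n ->
  exists2 sigma, 0 < sigma & forall x : 'cV[R]_n,
    sigma * dot x x <= dot (A *m x) (A *m x).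
Proof.
move=> rA; have /row_fullP[B BA] : row_full A by rewrite /row_full rA.
have [K K0 BK] := dot_mulmx_le B.
exists (K + 1)^-1; first by rewrite invr_gt0; lra.
move=> x; have := BK (A *m x); rewrite mulmxA BA mul1mx => h.
rewrite mulrC ler_pdivrMr; last lra.
have := dot_ge0 (A *m x); nra.
Qed.

Lemma unit_dot_le1 {R : realType} {n : nat} (x y : 'cV[R]_n) :
  dot x x = 1 -> dot y y = 1 -> dot x y <= 1.
Proof. by move=> x1 y1; have := dot_ge0 (x - y); rewrite dot_sqrB x1 y1; lra. Qed.

(** * Residuals and the objective *)

Lemma sqrB_le4 {R : realType} (x y M : R) :
  x ^+ 2 <= M -> y ^+ 2 <= M -> (x - y) ^+ 2 <= 4 * M.
Proof. by move=> hx hy; have := sqr_ge0 (x + y); nra. Qed.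

Section Residual.
Context {R : realType} {n1 n2 n3 : nat} {Omega : index_set n1 n2 n3}.
Variable w : enumeration Omega.
Implicit Types (A : tensor R n1 n2 n3) (X : 'I_n1 -> 'I_n2 -> R).

Definition point1 (p : triples Omega) := w (tag p) (val (tagged p)).1.
Definition point2 (p : triples Omega) := w (tag p) (val (tagged p)).2.

(** Taking an arbitrary matrix X instead of a rank-one one makes the residual
linear in X, so that it can also be applied to derivatives. *)
Definition residual A (p : triples Omega) X : R :=
  A (point1 p).1 (point1 p).2 (tag p) * X (point2 p).1 (point2 p).2 -
  A (point2 p).1 (point2 p).2 (tag p) * X (point1 p).1 (point1 p).2.

Definition rank1 (a : 'cV[R]_n1) (b : 'cV[R]_n2) i j := a i 0 * b j 0.

Lemma psiE A (p : triples Omega) a b :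
  psi w A (val (tagged p)).1 (val (tagged p)).2 a b
  = residual A p (rank1 a b) ^+ 2.
Proof.
rewrite /psi /residual -/(point1 p) -/(point2 p).
by case: (point1 p) => i j; case: (point2 p).
Qed.

Lemma objectiveE A a b :
  objective w A a b = \sum_p residual A p (rank1 a b) ^+ 2.
Proof.
rewrite /objective.
transitivity (\sum_(k < n3)
   \sum_(st : {st : 'I_#|slice Omega k| * 'I_#|slice Omega k| | (st.1 < st.2)%N})
     psi w A (val st).1 (val st).2 a b).
  apply: eq_bigr => k _; rewrite pair_big_dep /=.
  set T := ('I_#|slice Omega k| * 'I_#|slice Omega k|)%type.
  rewrite (reindex_omap (val : {st : T | (st.1 < st.2)%N} -> T) insub) /=.
    by apply: eq_bigl => -[st lt_st] /=; rewrite insubT lt_st eqxx.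
  by move=> st lt_st; rewrite insubT.
rewrite sig_big_dep /=.
by apply: eq_bigr => p _; rewrite psiE.
Qed.

Lemma objective_ge0 A a b : 0 <= objective w A a b.
Proof. by rewrite objectiveE; apply: sumr_ge0 => p _; rewrite sqr_ge0. Qed.

Lemma objective0_common_zero A a b :
  objective w A a b = 0 -> common_zero (Psi w A) a b.
Proof.
move=> /eqP; rewrite objectiveE psumr_eq0 => [/allP f0|p _]; last exact: sqr_ge0.
move=> _ [k [s [t [st ->]]]].
pose q : {st : 'I_#|slice Omega k| * 'I_#|slice Omega k| | (st.1 < st.2)%N} :=
  exist _ (s, t) st.
have := f0 (Tagged _ q) (mem_index_enum _) => /= /eqP.
by rewrite -psiE.
Qed.

Lemma objective_signs A (e1 e2 : R) a b : e1 ^+ 2 = 1 -> e2 ^+ 2 = 1 ->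
  objective w A (e1 *: a) (e2 *: b) = objective w A a b.
Proof.
move=> h1 h2; rewrite !objectiveE; apply: eq_bigr => p _.
have -> : residual A p (rank1 (e1 *: a) (e2 *: b)) =
    e1 * e2 * residual A p (rank1 a b).
  by rewrite /residual /rank1 !mxE mulrBr; congr (_ - _); ring.
by rewrite !exprMn h1 h2 !mul1r.
Qed.

Lemma tensor_norm_ge0 A : 0 <= tensor_norm Omega A.
Proof. exact: sqrtr_ge0. Qed.

Lemma tensor_entry_le A i j k : (i, j, k) \in Omega ->
  A i j k ^+ 2 <= tensor_norm Omega A ^+ 2.
Proof.
move=> ijk; rewrite /tensor_norm sqr_sqrtr; last first.
  by apply: sumr_ge0 => p _; rewrite sqr_ge0.
rewrite (bigD1 (i, j, k)) //= real_normK ?num_real // lerDl.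
by apply: sumr_ge0 => p _; rewrite sqr_ge0.
Qed.

Hypothesis w_enum : enumerates w.

Lemma enumerates_mem k s : ((w k s).1, (w k s).2, k) \in Omega.
Proof.
have : w k s \in slice Omega k by rewrite -w_enum; apply/imsetP; exists s.
by rewrite inE.
Qed.

Lemma point1_mem p : ((point1 p).1, (point1 p).2, tag p) \in Omega.
Proof. exact: enumerates_mem. Qed.

Lemma point2_mem p : ((point2 p).1, (point2 p).2, tag p) \in Omega.
Proof. exact: enumerates_mem. Qed.

(** Every coefficient in a residual is bounded by the tensor norm, since both
points of a triple lie in Omega.  This bounds the quadratic remainder near the
exact solution as well as the effect of the perturbation. *)
Lemma sum_residual_rank1_le A a b :
  \sum_p residual A p (rank1 a b) ^+ 2 <=
  4 * #|triples Omega|%:R * tensor_norm Omega A ^+ 2 * (dot a a * dot b b).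
Proof.
apply: (@le_trans _ _ (\sum_(p : triples Omega)
  4 * (tensor_norm Omega A ^+ 2 * (dot a a * dot b b)))).
  apply: ler_sum => p _.
  have h q i j : ((q.1, q.2, tag p) \in Omega) ->
    (A q.1 q.2 (tag p) * rank1 a b i j) ^+ 2 <=
    tensor_norm Omega A ^+ 2 * (dot a a * dot b b).
    move=> qO; rewrite exprMn; apply: ler_pM; rewrite ?sqr_ge0 //.
      exact: tensor_entry_le.
    by rewrite exprMn ler_pM ?sqr_ge0 ?sqr_coord_le_dot.
  apply: sqrB_le4; first exact/h/point1_mem.
  exact/h/point2_mem.
rewrite sumr_const -mulr_natl le_eqVlt; apply/orP; left; apply/eqP; ring.
Qed.

End Residual.

(** * The rank condition as a bound on the derivative of the residuals *)

Section Jacobian.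
Context {R : realType} {n1 n2 n3 : nat} {Omega : index_set n1 n2 n3}.
Variable w : enumeration Omega.
Variables (a : 'cV[R]_n1) (b : 'cV[R]_n2) (c : 'cV[R]_n3).

(** The derivative of (x, y) |-> rank1 x y at (a, b) in the direction
(u, v). *)
Definition rank1_deriv (u : 'cV[R]_n1) (v : 'cV[R]_n2) i j : R :=
  u i 0 * b j 0 + a i 0 * v j 0.

Lemma dot_delta n (i : 'I_n) (u : 'cV[R]_n) : dot (delta_mx i 0) u = u i 0.
Proof.
rewrite /dot (bigD1 i) //= !mxE !eqxx mul1r big1 ?addr0 // => j ji.
by rewrite !mxE (negbTE ji) mul0r.
Qed.

(** The vectors zvec are the gradients of the residuals at (a, b), scaled by
sqrt 2. *)
Lemma zvec_residual (p : triples Omega) u v :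
  dot (zvec w a b c (val (tagged p)).1 (val (tagged p)).2) (col_mx u v)
  = Num.sqrt 2 * residual w (outer3 a b c) p (rank1_deriv u v).
Proof.
rewrite /zvec /residual -/(point1 w p) -/(point2 w p).
case: (point1 w p) => i_s j_s; case: (point2 w p) => i_t j_t /=.
rewrite dotZl /dot big_split_ord /=.
under eq_bigr do rewrite !col_mxEu.
under [X in _ + X]eq_bigr do rewrite !col_mxEd.
rewrite -!/(dot _ _) !dotBl !dotZl !dot_delta /outer3 /rank1_deriv; ring.
Qed.

Lemma Zhat_residual u v :
  dot (Zhat w a b c *m col_mx u v) (Zhat w a b c *m col_mx u v)
  = 2 * \sum_p residual w (outer3 a b c) p (rank1_deriv u v) ^+ 2.
Proof.
rewrite (reindex (@enum_val (triples Omega) (mem (triples Omega)))) /=; last first.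
  by apply: onW_bij; apply: enum_val_bij.
rewrite mulr_sumr; apply: eq_bigr => r _.
rewrite -expr2 -[X in X * _](@sqr_sqrtr R 2) // -exprMn; congr (_ ^+ 2).
rewrite -zvec_residual mxE; apply: eq_bigr => i _; rewrite !mxE.
by case: (enum_val r) => k st /=; rewrite mxE.
Qed.

Lemma Dhat_dot u v :
  dot (Dhat a b *m col_mx u v) (Dhat a b *m col_mx u v)
  = dot a u ^+ 2 + dot b v ^+ 2.
Proof.
have -> : Dhat a b *m col_mx u v =
    col_mx (a^T *m u) (b^T *m v) :> 'cV[R]_(1 + 1).
  rewrite /Dhat tr_block_mx !trmx0.
  by rewrite (@mul_block_col _ 1 1 n1 n2) !mul0mx addr0 add0r.
rewrite (@dot_col_mx R 1 1).
rewrite /dot !big_ord1 !mxE -!expr2.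
by congr (_ ^+ 2 + _ ^+ 2); apply: eq_bigr => i _; rewrite mxE.
Qed.

Lemma Zmat_coercive : \rank (Zmat w a b c) = (n1 + n2)%N ->
  exists2 sigma, 0 < sigma & forall u v,
    sigma * (dot u u + dot v v) <=
    2 * \sum_p residual w (outer3 a b c) p (rank1_deriv u v) ^+ 2
    + dot a u ^+ 2 + dot b v ^+ 2.
Proof.
move=> /full_col_rank_coercive[sigma s0 hs]; exists sigma => // u v.
have := hs (col_mx u v); rewrite dot_col_mx /Zmat mul_col_mx dot_col_mx.
by rewrite Zhat_residual Dhat_dot addrA.
Qed.

End Jacobian.

(** * Growth of the objective near the exact solution *)

Section Growth.
Context {R : realType} {n1 n2 n3 : nat} {Omega : index_set n1 n2 n3}.
Variable w : enumeration Omega.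
Hypothesis w_enum : enumerates w.
Variables (a : 'cV[R]_n1) (b : 'cV[R]_n2) (c : 'cV[R]_n3).

Definition pair_sqdist (x : 'cV[R]_n1) (y : 'cV[R]_n2) : R :=
  dot (x - a) (x - a) + dot (y - b) (y - b).

Lemma residual_outer3 p : residual w (outer3 a b c) p (rank1 a b) = 0.
Proof. by rewrite /residual /outer3 /rank1; ring. Qed.

Lemma residual_taylor A p u v :
  residual w A p (rank1 a b) = 0 ->
  residual w A p (rank1 (a + u) (b + v)) =
  residual w A p (rank1_deriv a b u v) + residual w A p (rank1 u v).
Proof.
move=> h; rewrite -[RHS]add0r -h /residual /rank1 /rank1_deriv !mxE; ring.
Qed.

Hypotheses (a_unit : dot a a = 1) (b_unit : dot b b = 1).

(** With N the squared distance, the rank condition bounds the first-order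
part of the objective below by a multiple of N, up to the normal components
of the displacement.  Both these and the second-order part of the residuals
contribute O(N^2), which is absorbed when N is small. *)
Lemma objective_growth_near : \rank (Zmat w a b c) = (n1 + n2)%N ->
  exists r, exists k, [/\ 0 < r, 0 < k & forall x y,
    dot x x = 1 -> dot y y = 1 -> pair_sqdist x y <= r ->
    k * pair_sqdist x y <= objective w (outer3 a b c) x y].
Proof.
move=> /Zmat_coercive[sigma sigma0 hsigma].
pose K := 4 * #|triples Omega|%:R * tensor_norm Omega (outer3 a b c) ^+ 2.
have K0 : 0 <= K by rewrite /K mulr_ge0 ?sqr_ge0 // mulr_ge0 ?ler0n.
exists (sigma / (2 * (1 + 4 * K))), (sigma / 8).
split=> [||x y x1 y1].
- by rewrite divr_gt0 //; lra.
- by rewrite divr_gt0.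
rewrite ler_pdivlMr; last lra.
set u := x - a; set v := y - b.
have -> : pair_sqdist x y = dot u u + dot v v by [].
(* A chord of the unit sphere is orthogonal to the radius up to second order. *)
have au : dot a u = - dot u u / 2.
  by rewrite dot_sqrB x1 a_unit dotC dotBl a_unit; lra.
have bv : dot b v = - dot v v / 2.
  by rewrite dot_sqrB y1 b_unit dotC dotBl b_unit; lra.
have := hsigma u v; rewrite au bv.
have := sum_residual_rank1_le w w_enum (outer3 a b c) u v.
rewrite -/K.
(* (l + h)^2 >= l^2 / 2 - h^2 for each residual *)
have : (\sum_p residual w (outer3 a b c) p (rank1_deriv a b u v) ^+ 2) / 2
    - \sum_p residual w (outer3 a b c) p (rank1 u v) ^+ 2
    <= objective w (outer3 a b c) x y.
  rewrite objectiveE mulr_suml -sumrB; apply: ler_sum => p _.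
  have -> : x = a + u by rewrite addrC subrK.
  have -> : y = b + v by rewrite addrC subrK.
  rewrite residual_taylor ?residual_outer3 //.
  set l := residual _ _ _ _; set h := residual _ _ _ _.
  by have := sqr_ge0 (l + 2 * h); nra.
have u0 := dot_ge0 u; have v0 := dot_ge0 v.
(* U, V are the squared lengths of u and v, F the objective, H and L the sums
   of squares of the second- and first-order parts of the residuals. *)
move: (dot u u) (dot v v) (objective _ _ _ _) (\sum_p _) (\sum_p _) u0 v0.
move=> U V F H L U0 V0 hF hH hL hr.
set N := U + V in hr *.
have N0 : 0 <= N by rewrite addr_ge0.
have UV : U * V <= N ^+ 2 by rewrite /N; nra.
have sq : (- U / 2) ^+ 2 + (- V / 2) ^+ 2 <= N ^+ 2 by rewrite /N; nra.
have KUV : K * (U * V) <= K * N ^+ 2 by rewrite ler_wpM2l.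
have : N * (N * (2 * (1 + 4 * K))) <= N * sigma by rewrite ler_wpM2l.
have : sigma * N <= 2 * (2 * (F + H)) + N ^+ 2 by rewrite /N in hL sq *; lra.
have : 4 * H <= 4 * K * N ^+ 2 by lra.
nra.
Qed.

End Growth.

(** * Compactness and the lower bound away from the exact solution *)

Section Compactness.
Context {R : realType}.
Local Open Scope classical_set_scope.

Lemma continuous_sum {V : topologicalType} {I : finType} (f : I -> V -> R) :
  (forall i, continuous (f i)) -> continuous (fun x => \sum_i f i x).
Proof.
move=> cf; 
elim: (index_enum I) => [|i r IH] x.
  by under eq_fun do rewrite big_nil; exact: cvg_cst.
under eq_fun do rewrite big_cons.
by apply: cvgD; [exact: cf | exact: IH].
Qed.

Lemma compact_pos_lower_bound {V : topologicalType} {K : set V} {f : V -> R} :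
  compact K -> continuous f -> (forall x, K x -> 0 < f x) ->
  exists2 m, 0 < m & forall x, K x -> m <= f x.
Proof.
move=> cK cf f_pos; have [->|/set0P K0] := eqVneq K set0; first by exists 1.
have [|x /set_mem Kx fx] := compact_EVT_min K0 cK (f := f).
  exact: continuous_subspaceT.
by exists (f x); [exact: f_pos | move=> y Ky; apply: fx; rewrite inE].
Qed.

Lemma closed_box_compact {n} {K : set 'rV[R]_n} :
  closed K -> (forall v, K v -> forall i, `|v 0 i| <= 1) -> compact K.
Proof.
move=> clK Kbox.
have cB := @rV_compact R n (fun=> `[-1, 1]%classic) (fun=> @segment_compact _ _ _).
apply: (subclosed_compact clK cB) => v /Kbox h i /=.
by rewrite in_itv /= -ler_norml.
Qed.

End Compactness.
Section ContinuityOfObjective.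
Context {R : realType} {V : topologicalType}.

Lemma continuous_mul (f g : V -> R) :
  continuous f -> continuous g -> continuous (fun v => f v * g v).
Proof. by move=> cf cg v; apply: cvgM; [exact: cf | exact: cg]. Qed.

Lemma continuous_dot {n} {f g : V -> 'cV[R]_n} :
  (forall i, continuous (fun v => f v i 0)) ->
  (forall i, continuous (fun v => g v i 0)) ->
  continuous (fun v => dot (f v) (g v)).
Proof.
by move=> cf cg; apply: continuous_sum => i; exact: continuous_mul.
Qed.

Lemma continuous_objective {n1 n2 n3} {Omega : index_set n1 n2 n3}
    (w : enumeration Omega) (A : tensor R n1 n2 n3)
    {f : V -> 'cV[R]_n1} {g : V -> 'cV[R]_n2} :
  (forall i, continuous (fun v => f v i 0)) ->
  (forall i, continuous (fun v => g v i 0)) ->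
  continuous (fun v => objective w A (f v) (g v)).
Proof.
move=> cf cg; under eq_fun do rewrite objectiveE.
apply: continuous_sum => p; under eq_fun do rewrite expr2.
have c2 : continuous (fun v => residual w A p (rank1 (f v) (g v))).
  move=> v; apply: cvgB; (apply: cvgM; first exact: cvg_cst);
    exact: continuous_mul.
exact: continuous_mul.
Qed.

End ContinuityOfObjective.

Section GlobalGrowth.
Context {R : realType} {n1 n2 n3 : nat} {Omega : index_set n1 n2 n3}.
Variable w : enumeration Omega.
Variables (A : tensor R n1 n2 n3) (a : 'cV[R]_n1) (b : 'cV[R]_n2).
Hypotheses (a_unit : dot a a = 1) (b_unit : dot b b = 1).
Hypothesis zeros : forall x y, enorm x = 1 -> enorm y = 1 ->
  common_zero (Psi w A) x y -> (x = a \/ x = - a) /\ (y = b \/ y = - b).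

(** Compactness is used for row vectors, so a pair (x, y) is stored as one
row.  Among unit pairs the sign conditions exclude the zeros (- a, _) and
(_, - b), and the distance condition excludes (a, b). *)
Lemma objective_lower_bound_far r : 0 < r ->
  exists2 m, 0 < m & forall x y, dot x x = 1 -> dot y y = 1 ->
    0 <= dot a x -> 0 <= dot b y -> r <= pair_sqdist a b x y ->
    m <= objective w A x y.
Proof.
move=> r0.
pose X (v : 'rV[R]_(n1 + n2)) : 'cV_n1 := (lsubmx v)^T.
pose Y (v : 'rV[R]_(n1 + n2)) : 'cV_n2 := (rsubmx v)^T.
have cX i : continuous (fun v => X v i 0).
  by under eq_fun do rewrite /X !mxE; exact: coord_continuous.
have cY i : continuous (fun v => Y v i 0).
  by under eq_fun do rewrite /Y !mxE; exact: coord_continuous.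
pose K := [set v | [/\ dot (X v) (X v) = 1, dot (Y v) (Y v) = 1,
  0 <= dot a (X v), 0 <= dot b (Y v) & r <= pair_sqdist a b (X v) (Y v)]]%classic.
have ca i : continuous (fun _ : 'rV[R]_(n1 + n2) => a i 0) by exact: cst_continuous.
have cb i : continuous (fun _ : 'rV[R]_(n1 + n2) => b i 0) by exact: cst_continuous.
have caX : continuous (fun v => dot a (X v)) := continuous_dot (f := fun=> a) ca cX.
have cbY : continuous (fun v => dot b (Y v)) := continuous_dot (f := fun=> b) cb cY.
have clK : closed K.
  have -> : K = (
    (* On unit vectors the last condition is r <= pair_sqdist, as
       |x - a|^2 = 2 - 2 dot a x. *)
    ((fun v => dot (X v) (X v)) @^-1` [set t | t = 1]) `&`
    (((fun v => dot (Y v) (Y v)) @^-1` [set t | t = 1]) `&`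
    (((fun v => dot a (X v)) @^-1` [set t | 0 <= t]) `&`
    (((fun v => dot b (Y v)) @^-1` [set t | 0 <= t]) `&`
    ((fun v => dot a (X v) + dot b (Y v)) @^-1` [set t | t <= 2 - r / 2])))))%classic.
    apply/seteqP; split=> v /=.
      move=> [x1 y1 ax hby]; rewrite /pair_sqdist !dot_sqrB x1 y1 a_unit b_unit.
      by rewrite (dotC _ a) (dotC _ b) => h; do 4!split => //; lra.
    move=> [x1 [y1 [ax [hby h]]]]; split => //.
    rewrite /pair_sqdist !dot_sqrB x1 y1 a_unit b_unit.
    by rewrite (dotC _ a) (dotC _ b); lra.
  do !apply: closedI; (apply: preimage_closed; [move=> v _ | by []]).
  - exact: (continuous_dot cX cX).
  - exact: (continuous_dot cY cY).
  - exact: caX.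
  - exact: cbY.
  - exact: (cvgD (caX v) (cbY v)).
have sqr_le1 (t : R) : t ^+ 2 <= 1 -> `|t| <= 1.
  by rewrite -[X in _ <= X -> _](expr1n _ 2%N) -real_normK ?num_real ?ler_sqr ?nnegrE.
have cK : compact K.
  apply: closed_box_compact clK _ => v [x1 y1 _ _ _] i; apply: sqr_le1.
  case: (split_ordP i) => j ->.
    by have := sqr_coord_le_dot (X v) j; rewrite x1 !mxE.
  by have := sqr_coord_le_dot (Y v) j; rewrite y1 !mxE.
have [|m m0 hm] := compact_pos_lower_bound cK (continuous_objective w A cX cY).
  move=> v [x1 y1 ax hby far]; rewrite lt_def objective_ge0 andbT; apply/eqP.
  move=> /objective0_common_zero z.
  have [hx hy] := zeros _ _ (enorm1_dot _ x1) (enorm1_dot _ y1) z.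
  have {hx} hx : X v = a.
    by case: hx => // hx; move: ax; rewrite hx dotC -scaleN1r dotZl a_unit mulr1 ler0N1.
  have {hy} hy : Y v = b.
    by case: hy => // hy; move: hby; rewrite hy dotC -scaleN1r dotZl b_unit mulr1 ler0N1.
  move: far; rewrite hx hy {hx hy z} /pair_sqdist !subrr.
  by rewrite !dot0l addr0 leNgt r0.
exists m => // x y x1 y1 ax hby far.
have eX : X (row_mx x^T y^T) = x by rewrite /X row_mxKl trmxK.
have eY : Y (row_mx x^T y^T) = y by rewrite /Y row_mxKr trmxK.
by have := hm (row_mx x^T y^T); rewrite /K /= eX eY; apply.
Qed.

End GlobalGrowth.

(** * Global growth and the perturbation estimate *)

Section Perturbation.
Context {R : realType} {n1 n2 n3 : nat} {Omega : index_set n1 n2 n3}.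
Variables (w : enumeration Omega) (w_enum : enumerates w).
Variables (a : 'cV[R]_n1) (b : 'cV[R]_n2) (c : 'cV[R]_n3).
Hypotheses (a_unit : dot a a = 1) (b_unit : dot b b = 1).

(** Far from (a, b) a constant lower bound m is a linear one, because the
squared distance is at most 4: each of its two terms is 2 - 2 dot with a
nonnegative inner product. *)
Lemma objective_growth : \rank (Zmat w a b c) = (n1 + n2)%N ->
  (forall x y, enorm x = 1 -> enorm y = 1 ->
    common_zero (Psi w (outer3 a b c)) x y ->
    (x = a \/ x = - a) /\ (y = b \/ y = - b)) ->
  exists2 k, 0 < k & forall x y,
    dot x x = 1 -> dot y y = 1 -> 0 <= dot a x -> 0 <= dot b y ->
    k * pair_sqdist a b x y <= objective w (outer3 a b c) x y.
Proof.
move=> /(objective_growth_near w w_enum _ _ _ a_unit b_unit)[r [k [r0 k0 near_ab]]] zeros.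
have [m m0 far_ab] := objective_lower_bound_far w _ _ _ a_unit b_unit zeros _ r0.
exists (Num.min k (m / 4)); first by rewrite lt_min k0 divr_gt0.
move=> x y x1 y1 ax hby.
have D0 : 0 <= pair_sqdist a b x y by rewrite addr_ge0 ?dot_ge0.
have [near|far] := leP (pair_sqdist a b x y) r.
  by apply: le_trans (near_ab _ _ x1 y1 near); rewrite ler_wpM2r ?ge_min ?lexx.
apply: le_trans (far_ab _ _ x1 y1 ax hby (ltW far)).
apply: (@le_trans _ _ (m / 4 * pair_sqdist a b x y)).
  by rewrite ler_wpM2r // ge_min lexx orbT.
have : pair_sqdist a b x y <= 4.
  rewrite /pair_sqdist !dot_sqrB x1 y1 a_unit b_unit (dotC _ a) (dotC _ b); lra.
by move=> h; nra.
Qed.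

Lemma objective_residual_le (A B C : tensor R n1 n2 n3) x y :
  (forall i j k, (i, j, k) \in Omega -> A i j k = B i j k + C i j k) ->
  objective w B x y <= 2 * objective w A x y + 2 * objective w C x y.
Proof.
move=> ABC; rewrite !objectiveE !mulr_sumr -big_split; apply: ler_sum => p _ /=.
have -> : residual w A p (rank1 x y) =
    residual w B p (rank1 x y) + residual w C p (rank1 x y).
  rewrite /residual !ABC ?point1_mem ?point2_mem //; ring.
set s := residual _ _ _ _; set t := residual _ _ _ _.
by have := sqr_ge0 (s + 2 * t); nra.
Qed.

(** The minimizer is compared with (a, b), where the perturbed objective only
sees dA.  Each of the two objectives of dA is at most 4 #|triples| T^2, and
each enters with a factor 2. *)
Lemma minimizer_objective_le (A dA : tensor R n1 n2 n3) x y :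
  (forall i j k, (i, j, k) \in Omega ->
     A i j k = outer3 a b c i j k + dA i j k) ->
  minimizer w A x y ->
  objective w (outer3 a b c) x y <=
    16 * #|triples Omega|%:R * tensor_norm Omega dA ^+ 2.
Proof.
move=> hA [[x1 y1] /(_ a b) min_xy].
rewrite !enorm_dot in x1 y1.
have {min_xy} : objective w A x y <= objective w dA a b.
  apply: le_trans (min_xy _) _; first by rewrite /feasible !enorm_dot.
  rewrite !objectiveE le_eqVlt; apply/orP; left; apply/eqP.
  apply: eq_bigr => p _; congr (_ ^+ 2).
  have := residual_outer3 w a b c p.
  rewrite /residual !hA ?point1_mem ?point2_mem // !mulrDl => /eqP.
  rewrite subr_eq0 => /eqP ->; ring.
have := objective_residual_le _ _ _ x y hA.
have := sum_residual_rank1_le w w_enum dA x y.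
have := sum_residual_rank1_le w w_enum dA a b.
rewrite -!objectiveE x1 y1 a_unit b_unit; lra.
Qed.

End Perturbation.

Theorem theorem3p1 (R : realType) (n1 n2 n3 : nat)
  (n1_gt0 : (0 < n1)%N) (n2_gt0 : (0 < n2)%N) (n3_gt0 : (0 < n3)%N)
  (Omega : index_set n1 n2 n3)
  (w : enumeration Omega) (w_enum : enumerates w)
  (ah : 'cV[R]_n1) (bh : 'cV[R]_n2) (ch : 'cV[R]_n3)
  (ah_neq0 : ah <> 0) (bh_neq0 : bh <> 0) (ch_neq0 : ch <> 0)
  (ah_unit : enorm ah = 1) (bh_unit : enorm bh = 1)
  (rankZ : \rank (Zmat w ah bh ch) = (n1 + n2)%N)
  (only_zeros : forall (a : 'cV[R]_n1) (b : 'cV[R]_n2),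
     enorm a = 1 /\ enorm b = 1 /\ common_zero (Psi w (outer3 ah bh ch)) a b
     <-> (a = ah \/ a = - ah) /\ (b = bh \/ b = - bh)) :
  exists C1 : R, 0 < C1 /\
  exists eps : R, 0 < eps /\
  forall A dA : tensor R n1 n2 n3,
    (forall i j k, (i, j, k) \in Omega ->
       A i j k = outer3 ah bh ch i j k + dA i j k) ->
    tensor_norm Omega dA < eps ->
    forall (a : 'cV[R]_n1) (b : 'cV[R]_n2), minimizer w A a b ->
    exists theta : R, (theta = -1 \/ theta = 1) /\
      enorm (kron a b - theta *: kron ah bh) <= C1 * tensor_norm Omega dA.
Proof.
have ah1 : dot ah ah = 1 by rewrite -enorm_dot ah_unit expr1n.
have bh1 : dot bh bh = 1 by rewrite -enorm_dot bh_unit expr1n.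
have [k k0 growth] := objective_growth w w_enum _ _ _ ah1 bh1 rankZ
  (fun x y x1 y1 z => (only_zeros x y).1 (conj x1 (conj y1 z))).
pose M : R := 16 * #|triples Omega|%:R / k.
have M0 : 0 <= M by rewrite divr_ge0 ?mulr_ge0 ?ler0n // ltW.
(* M vanishes when there are no residuals, hence the + 1. *)
exists (Num.sqrt M + 1); split; first by have := sqrtr_ge0 M; lra.
exists 1; split=> // A dA hA _ a b min_ab.
have [[]] := min_ab; rewrite !enorm_dot => a1 b1 _.
have := minimizer_objective_le w w_enum _ _ _ ah1 bh1 _ _ _ _ hA min_ab.
(* The signs that turn (a, b) towards (ah, bh); their product is theta. *)
have sgn n (u v : 'cV[R]_n) :
    exists2 e : R, e = -1 \/ e = 1 & 0 <= dot u (e *: v).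
  have [uv|uv] := leP 0 (dot u v); [exists 1|exists (-1)]; try by [left|right].
    by rewrite scale1r.
  by rewrite dotC dotZl dotC; lra.
have [e1 he1 ae1] := sgn _ ah a; have [e2 he2 be2] := sgn _ bh b.
have sq1 : e1 ^+ 2 = 1 by case: he1 => ->; rewrite ?sqrrN expr1n.
have sq2 : e2 ^+ 2 = 1 by case: he2 => ->; rewrite ?sqrrN expr1n.
have dotee n (e : R) (u : 'cV[R]_n) : e ^+ 2 = 1 -> dot u u = 1 -> dot (e *: u) (e *: u) = 1.
  by move=> ee u1; rewrite dotZl dotC dotZl u1 mulr1 -expr2.
have ea1 := dotee _ _ _ sq1 a1; have eb1 := dotee _ _ _ sq2 b1.
rewrite -(objective_signs w _ _ _ a b sq1 sq2) => hF.
have hD := growth _ _ ea1 eb1 ae1 be2.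
exists (e1 * e2); split.
  by case: he1 => ->; case: he2 => ->; rewrite ?mulrNN ?mulr1 ?mul1r; [right|left|left|right].
have le1 := unit_dot_le1 _ _ ah1 ea1; have le2 := unit_dot_le1 _ _ bh1 eb1.
have ek : dot (kron a b - (e1 * e2) *: kron ah bh) (kron a b - (e1 * e2) *: kron ah bh)
    <= pair_sqdist ah bh (e1 *: a) (e2 *: b).
  rewrite /pair_sqdist !dot_sqrB ea1 eb1 ah1 bh1 (dotC (kron a b)) !dotZl.
  rewrite (dotC (kron ah bh) (_ *: _)) dotZl !dot_kron a1 b1 ah1 bh1.
  have -> : (e1 * e2) * ((e1 * e2) * (1 * 1)) = 1.
    by transitivity (e1 ^+ 2 * e2 ^+ 2); [ring | rewrite sq1 sq2 mulr1].
  have -> : (e1 * e2) * (dot ah a * dot bh b) = (e1 * dot a ah) * (e2 * dot b bh).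
    by rewrite (dotC ah) (dotC bh); ring.
  move: le1 le2; rewrite (dotC ah) (dotC bh) !dotZl; nra.
have T0 := tensor_norm_ge0 (Omega := Omega) dA.
rewrite -ler_sqr ?nnegrE ?enorm_ge0 ?mulr_ge0 //; last by have := sqrtr_ge0 M; lra.
rewrite enorm_dot; apply: le_trans ek _.
apply: (@le_trans _ _ (M * tensor_norm Omega dA ^+ 2)).
  rewrite /M mulrAC ler_pdivlMr // mulrC; exact: le_trans hD hF.
rewrite exprMn ler_wpM2r ?sqr_ge0 // -{1}(sqr_sqrtr M0).
by have := sqrtr_ge0 M; nra.
Qed.
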